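(* Let $F\in\varGamma$ be continuous and let $t:[0,1]\to[0,\infty]$ be a left continuous non-decreasing function such that $F(t(x),t(0^+))<F(t(x),t(y))$ for all $x,y\in(0,1)$. Let $T:[0,1]^2\to[0,1]$ be given by $T(x,y)=t^{[-1]}(F(t(x),t(y)))$. Then the following are equivalent: (i) $T$ is a continuous t-conorm. (ii) $t$ is a continuous strictly increasing function on $(0,1]$ and $F(t(0^+),t(0^+))=t(0^+)$.
   Context: $\varGamma$ is the set of all functions $F:[0,\infty]^2\to[0,\infty]$ such that $([0,\infty],F,\le)$ is a fully ordered Abelian semigroup (i.e. $F$ is associative, commutative and non-decreasing in each argument) and $F(x,0)\ge x$ for all $x\in[0,\infty]$. For non-decreasing $t:[0,1]\to[0,\infty]$, the weak pseudo-inverse $t^{[-1]}:[0,\infty]\to[0,1]$ is $t^{[-1]}(y)=\sup\{x\in[0,1]\mid t(x)\le y\}$ (with $\sup\emptyset=0$) if $t$ is non-constant, and $t^{[-1]}(y)=1$ for all $y$ if $t$ is constant. $t(0^+)=\lim_{s\to0^+}t(s)$. A t-conorm is a binary operation $S:[0,1]^2\to[0,1]$ that is commutative, associative, non-decreasing in each argument, and satisfies $S(x,0)=x$ for all $x\in[0,1]$. *)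

(* Defs.v *)
From HB Require Import structures.
From mathcomp Require Import all_boot all_order all_algebra.
From mathcomp Require Import all_classical all_reals all_analysis.

Set Implicit Arguments.
Unset Strict Implicit.
Unset Printing Implicit Defensive.

Import Order.TTheory GRing.Theory Num.Theory.
Import numFieldNormedType.Exports.

Local Open Scope classical_set_scope.
Local Open Scope ring_scope.

(* Functions on [0, 1] or [0, +oo] are represented by functions on the whole
   of R or \bar R; every condition below only concerns their values on the
   intended domain. *)

Section Defs.
Variable R : realType.
Implicit Types (F : \bar R -> \bar R -> \bar R) (t : R -> \bar R)
  (S : R -> R -> R).

Definition nnereal : interval (\bar R) := `[0%E, +oo%E].

Definition unit_itv : interval R := `[0, 1].

Record Gamma F : Prop := MkGamma {
  Gamma_closed : {in nnereal &, forall u v, F u v \in nnereal} ;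
  Gamma_assoc : {in nnereal & &, forall u v w, F u (F v w) = F (F u v) w} ;
  Gamma_comm : {in nnereal &, forall u v, F u v = F v u} ;
  Gamma_monol : {in nnereal & &, forall u v w, (u <= v)%E -> (F u w <= F v w)%E} ;
  Gamma_monor : {in nnereal & &, forall u v w, (u <= v)%E -> (F w u <= F w v)%E} ;
  Gamma_ge : {in nnereal, forall u, (u <= F u 0)%E} }.

Definition Gamma_continuous F : Prop :=
  {within [set` nnereal] `*` [set` nnereal],
    continuous (fun p : \bar R * \bar R => F p.1 p.2)}.

Definition nondecreasing_unit t : Prop :=
  {in unit_itv &, forall x y, x <= y -> (t x <= t y)%E}.

(* Left continuity at 0 is vacuous for a function on [0, 1]. *)
Definition left_continuous_unit t : Prop :=
  forall x : R, x \in `]0, 1] -> t z @[z --> x^'-] --> t x.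

Definition rlim0 t : \bar R := lim (t s @[s --> (0 : R)^'+]).

Definition constant_unit t : Prop :=
  {in unit_itv &, forall x y, t x = t y}.

(* The library's sup satisfies sup set0 = 0. *)
Definition weak_pinv t (y : \bar R) : R :=
  if `[< constant_unit t >] then 1
  else sup [set x : R | x \in unit_itv /\ (t x <= y)%E].

Definition generated_op F t (x y : R) : R := weak_pinv t (F (t x) (t y)).

Record tconorm S : Prop := MkTconorm {
  tconorm_closed : {in unit_itv &, forall x y, S x y \in unit_itv} ;
  tconorm_comm : {in unit_itv &, forall x y, S x y = S y x} ;
  tconorm_assoc : {in unit_itv & &, forall x y z, S x (S y z) = S (S x y) z} ;
  tconorm_monol : {in unit_itv & &, forall x y z, x <= y -> S x z <= S y z} ;
  tconorm_monor : {in unit_itv & &, forall x y z, x <= y -> S z x <= S z y} ;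
  tconorm_neutral : {in unit_itv, forall x, S x 0 = x} }.

Definition continuous_unit2 S : Prop :=
  {within [set` unit_itv] `*` [set` unit_itv],
    continuous (fun p : R * R => S p.1 p.2)}.

End Defs.

(* Main.v *)
Require Import Defs.
From HB Require Import structures.
From mathcomp Require Import all_boot all_order all_algebra.
From mathcomp Require Import all_classical all_reals all_analysis.

Set Implicit Arguments.
Unset Strict Implicit.
Unset Printing Implicit Defensive.

Import Order.TTheory GRing.Theory Num.Theory.
Import numFieldNormedType.Exports.

Local Open Scope classical_set_scope.
Local Open Scope ring_scope.

(** Write a for the right limit of t at 0.  Two facts drive both implications.

    First, left continuity of t turns the pseudo-inverse into an upper adjoint:
    z <= T x y if and only if t z <= F (t x) (t y) (le_generated_op).  Every
    property of T can thus be tested through inequalities between values of t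
    and of F.

    Second, if a is idempotent for F then a is neutral on [a, +oo]: by the
    intermediate value theorem every u >= a is of the form F w a, so that
    F u a = F w (F a a) = F w a = u (Gamma_idempotent_neutral).  As F u 0 >= u,
    every element of [0, a] is then neutral on [a, +oo] as well, which covers
    the value t 0 although t may jump at 0.

    Sufficiency.  Since t is strictly increasing and continuous on (0, 1],
    t (T x y) = F (t x) (t y) whenever x > 0 and T x y < 1.  As F dominates its
    arguments, truncation at 1 is harmless and associativity of T reduces to
    that of F.  Replacing t 0 by a changes neither T nor its adjunction, and
    makes t continuous on the whole of [0, 1]; continuity of T follows.

    Necessity.  T x 0 = x forces t to be strictly increasing, and continuity of
    T at (0, 0) forces F a a <= t z for all z > 0, hence F a a = a.  If t jumped
    at a point x of (0, 1), continuity of F (t x) at a would give some y in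
    (0, 1) with F (t x) (t y) below the jump, so T x y = x.  The intermediate
    value theorem and associativity propagate this equality to T z y = z for all
    z in [x, 1] (as z = T x w for some w).  So F (t z) (t y) < t m for all z < m
    close to m, and in the limit F (t m) (t y) <= t m <= F (t m) a, which
    contradicts the strict inequality assumed between F (t m) a and
    F (t m) (t y). *)

(** * Limits in order topologies and the extended reals *)

Section OrderTopology.
Context {d : Order.disp_t} {T : orderTopologicalType d}.
Context {X : Type} {G : set_system X} {FG : Filter G}.
Implicit Types (f : X -> T) (l e : T).
Local Open Scope order_scope.

Lemma cvg_near_lt f l e : f @ G --> l -> l < e -> \forall x \near G, f x < e.
Proof.
move=> fl le; have : nbhs l `]-oo, e[%classic.
  by apply: open_nbhs_nbhs; split; [exact: lray_open | rewrite /= in_itv].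
move=> /fl near_e; have {}near_e : G (f @^-1` `]-oo, e[) by [].
by apply: filterS near_e => x /=; rewrite in_itv.
Qed.

Lemma cvg_near_gt f l e : f @ G --> l -> e < l -> \forall x \near G, e < f x.
Proof.
move=> fl le; have : nbhs l `]e, +oo[%classic.
  by apply: open_nbhs_nbhs; split; [exact: rray_open | rewrite /= in_itv /= le].
move=> /fl near_e; have {}near_e : G (f @^-1` `]e, +oo[) by [].
by apply: filterS near_e => x /=; rewrite in_itv andbT.
Qed.

Lemma cvg_order f l :
  (forall e, e < l -> \forall x \near G, e < f x) ->
  (forall e, l < e -> \forall x \near G, f x < e) -> f @ G --> l.
Proof.
move=> fgt flt W; rewrite itv_nbhsE => -[[lo hi] [oi li] iW].
have near_lo : \forall x \near G, (lo <= BLeft (f x)).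
  case: lo oi li {iW} => [[] b|[]] //=; try by case: hi => [[]?|[]].
  - move=> _; rewrite in_itv => /andP[bl _].
    by apply: filterS (fgt _ bl).
  - by move=> _ _; apply: filterE.
have near_hi : \forall x \near G, (BRight (f x) <= hi).
  case: hi oi li {iW near_lo} => [[] b|[]] //=; try by case: lo => [[]?|[]].
  - move=> _; rewrite in_itv => /andP[_ lb].
    by apply: filterS (flt _ lb).
  - by move=> _ _; apply: filterE.
apply: filterS2 near_lo near_hi => x xlo xhi; apply: iW.
by rewrite /= itv_boundlr xlo.
Qed.

End OrderTopology.

(** Composition rule for a binary operation that is only known to be continuous
    on the square of its domain. *)
Lemma within_square_cvg {X : Type} {U V : topologicalType} {G : set_system X}
    {FG : Filter G} (A : set U) (h : U * U -> V) (f g : X -> U) (u v : U) :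
  {within A `*` A, continuous h} -> A u -> A v ->
  (\forall x \near G, A (f x)) -> (\forall x \near G, A (g x)) ->
  f @ G --> u -> g @ G --> v -> h (f x, g x) @[x --> G] --> h (u, v).
Proof.
move=> /subspace_continuousP hA Au Av Af Ag fu gv.
have fg : (f x, g x) @[x --> G] --> (u, v) by exact: cvg_pair.
apply: (cvg_comp (fun x => (f x, g x)) _ _ (hA (u, v) _)) => //.
move=> W /= /fg; rewrite /= !nbhs_simpl => H.
by apply: filterS3 Af Ag H => x /= ? ? ; apply.
Qed.

Lemma ereal_between {R : realFieldType} (x y : \bar R) :
  (x < y)%E -> exists z, (x < z < y)%E.
Proof.
case: x => [x| |]; case: y => [y| |] //=.
- rewrite lte_fin => xy; exists ((x + y) / 2)%:E.
  by rewrite !lte_fin !midf_lt.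
- by move=> _; exists (x + 1)%:E; rewrite lte_fin ltrDl ltr01 ltry.
- by move=> _; exists (y - 1)%:E; rewrite ltNyr lte_fin gtrDl ltrN10.
- by move=> _; exists 0%E; rewrite ltNyr ltry.
Qed.

(** The largest point s with f s <= u exists because sublevel sets are closed.
    If f s < u, the least point i >= s with u <= f i is distinct from s, and a
    point strictly between s and i would contradict one of the two
    extremalities. *)
Lemma ereal_IVT {R : realType} (f : \bar R -> \bar R) (x u : \bar R) :
  continuous f -> (f x <= u <= f +oo)%E -> exists v, f v = u.
Proof.
move=> fc /andP[fxu ufy].
have cl_le : closed (f @^-1` `]-oo, u]).
  by apply: closed_comp => [y _|]; [exact: fc | exact: lray_closed].
have cl_ge : closed (f @^-1` `[u, +oo[).
  by apply: closed_comp => [y _|]; [exact: fc | exact: rray_closed].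
set D := f @^-1` `]-oo, u] in cl_le.
pose s := ereal_sup D.
have Ds : D s.
  apply: (itv_closed_supremums _ cl_le); first by exists x; rewrite /D/= in_itv.
  by split; [exact: ereal_sup_ubound | move=> z; exact: ge_ereal_sup].
have fsu : (f s <= u)%E by move: Ds; rewrite /D/= in_itv.
pose E := f @^-1` `[u, +oo[ `&` `[s, +oo[.
have E0 : E +oo%E by split; rewrite /= in_itv/= andbT// leey.
pose i := ereal_inf E.
have [] : E i.
  apply: itv_closed_infimums; first by exists +oo%E.
    by apply: closedI => //; exact: rray_closed.
  by split; [exact: ereal_inf_lbound | move=> z; exact: le_ereal_inf_tmp].
rewrite /= !in_itv/= !andbT => ufi si.
have [is_eq|si_neq] := eqVneq i s.
  by exists s; apply/eqP; rewrite eq_le fsu -is_eq.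
have [z /andP[sz zi]] : exists z, (s < z < i)%E.
  by apply: ereal_between; rewrite lt_neqAle eq_sym si_neq.
have [fzu|ufz] := leP (f z) u.
  have : (z <= s)%E by apply: ereal_sup_ubound; rewrite /D/= in_itv.
  by rewrite leNgt sz.
have : (i <= z)%E.
  by apply: ereal_inf_lbound; split; rewrite /= in_itv/= andbT ltW.
by rewrite leNgt zi.
Qed.

Lemma in_unitE {R : realType} (x : R) : (x \in unit_itv R) = (0 <= x <= 1).
Proof. by rewrite /unit_itv in_itv. Qed.

Lemma in_nnerealE {R : realType} (u : \bar R) : (u \in nnereal R) = (0 <= u)%E.
Proof. by rewrite /nnereal in_itv /= leey andbT. Qed.

(** * Ordered semigroups on the nonnegative extended reals *)

Section GammaTheory.
Context {R : realType} {F : \bar R -> \bar R -> \bar R}.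
Hypothesis F_Gamma : Gamma F.
Implicit Types u v w a : \bar R.
Local Open Scope ereal_scope.

Lemma Gamma_ge0 u v : 0 <= u -> 0 <= v -> 0 <= F u v.
Proof.
move=> u0 v0; rewrite -in_nnerealE.
by apply: (Gamma_closed F_Gamma); rewrite in_nnerealE.
Qed.

Lemma Gamma_A u v w : 0 <= u -> 0 <= v -> 0 <= w -> F u (F v w) = F (F u v) w.
Proof. by move=> *; apply: (Gamma_assoc F_Gamma); rewrite in_nnerealE. Qed.

Lemma Gamma_C u v : 0 <= u -> 0 <= v -> F u v = F v u.
Proof. by move=> *; apply: (Gamma_comm F_Gamma); rewrite in_nnerealE. Qed.

Lemma Gamma_le2 u u' v v' : 0 <= u -> 0 <= v -> u <= u' -> v <= v' ->
  F u v <= F u' v'.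
Proof.
move=> u0 v0 uu' vv'; have u'0 := le_trans u0 uu'; have v'0 := le_trans v0 vv'.
apply: (@le_trans _ _ (F u' v)).
  by apply: (Gamma_monol F_Gamma); rewrite ?in_nnerealE.
by apply: (Gamma_monor F_Gamma); rewrite ?in_nnerealE.
Qed.

Lemma Gamma_gel u v : 0 <= u -> 0 <= v -> u <= F u v.
Proof.
move=> u0 v0; apply: (@le_trans _ _ (F u 0)); last exact: Gamma_le2.
by apply: (Gamma_ge F_Gamma); rewrite in_nnerealE.
Qed.

Lemma Gamma_ger u v : 0 <= u -> 0 <= v -> v <= F u v.
Proof. by move=> u0 v0; rewrite Gamma_C// Gamma_gel. Qed.

Hypothesis F_cont : Gamma_continuous F.

Lemma Gamma_cvg {X : Type} {G : set_system X} {FG : Filter G}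
    (f g : X -> \bar R) u v :
  0 <= u -> 0 <= v ->
  (\forall x \near G, 0 <= f x) -> (\forall x \near G, 0 <= g x) ->
  f @ G --> u -> g @ G --> v -> F (f x) (g x) @[x --> G] --> F u v.
Proof.
move=> u0 v0 f0 g0 fu gv.
apply: (within_square_cvg F_cont) fu gv; rewrite /= ?in_nnerealE//.
  by apply: filterS f0 => x; rewrite in_nnerealE.
by apply: filterS g0 => x; rewrite in_nnerealE.
Qed.

(** F (-) a takes the values a at a and +oo at +oo, so it reaches every u >= a;
    idempotency of a then absorbs the second application of F (-) a. *)
Lemma Gamma_idempotent_neutral a u : 0 <= a -> F a a = a -> a <= u -> F u a = u.
Proof.
move=> a0 Faa au.
(* Truncating the argument at a gives a function continuous on all of \bar R. *)
have [v Fva] : exists v, F (maxe a v) a = u.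
  apply: (@ereal_IVT _ (fun v => F (maxe a v) a) a); last first.
    rewrite maxxx Faa au maxey /=.
    by rewrite (le_trans (leey u))// Gamma_gel// leey.
  move=> v; apply: Gamma_cvg => //.
  - by rewrite le_max a0.
  - by apply: nearW => w; rewrite le_max a0.
  - by apply: nearW.
  - by apply: (max_fun_continuous (f := cst a)) => w;
      [exact: cvg_cst | exact: cvg_id].
  - exact: cvg_cst.
have w0 : 0 <= maxe a v by rewrite le_max a0.
by rewrite -Fva -Gamma_A// Faa.
Qed.

Lemma Gamma_idempotent_neutral_le a u v : 0 <= a -> F a a = a ->
  0 <= v -> v <= a -> a <= u -> F u v = u.
Proof.
move=> a0 Faa v0 va au; have u0 := le_trans a0 au.
apply/eqP; rewrite eq_le Gamma_gel// andbT.
rewrite -[leRHS](Gamma_idempotent_neutral a0 Faa au).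
exact: Gamma_le2.
Qed.

End GammaTheory.

(** * The right limit at 0 and the pseudo-inverse of a generator *)

Section Rlim0.
Context {R : realType} {t : R -> \bar R}.
Hypothesis t_nondecr : nondecreasing_unit t.

Lemma near0_unit : \forall s \near (0 : R)^'+, s \in `]0, 1[.
Proof.
near=> s; rewrite in_itv/=; apply/andP; split; near: s.
  exact: nbhs_right_gt.
exact: nbhs_right_lt.
Unshelve. all: by end_near. Qed.

Lemma generator_le x y : 0 <= x -> x <= y -> y <= 1 -> (t x <= t y)%E.
Proof.
move=> x0 xy y1; apply: t_nondecr; rewrite ?in_unitE ?x0 ?y1 ?andbT//=.
  exact: le_trans xy y1.
exact: le_trans x0 xy.
Qed.

Lemma rlim0_cvg : t s @[s --> (0 : R)^'+] --> rlim0 t.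
Proof.
apply: nondecreasing_at_right_is_cvge; near=> x => y z.
rewrite !in_itv/= => /andP[y0 yx] /andP[z0 zx] yz.
apply: generator_le => //; first exact: ltW.
by apply: ltW; apply: lt_trans zx _; near: x; exact: nbhs_right_lt.
Unshelve. all: by end_near. Qed.

Lemma rlim0_le x : 0 < x -> x <= 1 -> (rlim0 t <= t x)%E.
Proof.
move=> x0 x1; apply: (cvge_to_le rlim0_cvg); near=> s.
have s0 : 0 <= s by near: s; exact: nbhs_right_ge.
have sx : s <= x by near: s; exact: nbhs_right_le.
exact: generator_le.
Unshelve. all: by end_near. Qed.

Lemma le_rlim0 u : (forall x, 0 < x < 1 -> (u <= t x)%E) -> (u <= rlim0 t)%E.
Proof.
move=> ut; apply: (cvge_to_ge rlim0_cvg).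
by apply: filterS near0_unit => s; rewrite in_itv/=; exact: ut.
Qed.

Lemma generator0_le_rlim0 : (t 0 <= rlim0 t)%E.
Proof.
by apply: le_rlim0 => x /andP[x0 x1]; apply: generator_le => //; exact: ltW.
Qed.

Hypothesis t_lcont : left_continuous_unit t.

Lemma weak_pinv_unit y : 0 <= weak_pinv t y <= 1.
Proof.
rewrite /weak_pinv; case: ifP => _; first by rewrite ler01 lexx.
set S := [set x | _]; have [->|/set0P[x Sx]] := eqVneq S set0.
  by rewrite sup0 lexx ler01.
have S1 : ubound S 1 by move=> z [/=]; rewrite in_unitE => /andP[].
apply/andP; split; last by apply: ge_sup => //; exists x.
have [x01 _] := Sx; rewrite in_unitE in x01; have /andP[x0 _] := x01.
by apply: (le_trans x0); apply: ub_le_sup => //; exists 1.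
Qed.

(** Left continuity makes the supremum that defines the pseudo-inverse a
    maximum, whence an adjunction. The assumption on t 0 keeps the set of the
    supremum nonempty. *)
Lemma le_weak_pinv (z : R) (y : \bar R) : ~ constant_unit t -> (t 0 <= y)%E ->
  0 <= z <= 1 -> (z <= weak_pinv t y) = (t z <= y)%E.
Proof.
move=> /asboolPn/negbTE nc t0y z01; have := weak_pinv_unit y.
rewrite /weak_pinv nc; set S := [set x | _]; set s := sup S => /andP[s0 s1].
have S0 : S 0 by split; rewrite // in_unitE lexx ler01.
have supS : has_sup S.
  by split; [exists 0 | exists 1 => x [/=]; rewrite in_unitE => /andP[]].
have /andP[z0 z1] := z01.
apply/idP/idP => [zs|tzy]; last first.
  by apply: sup_upper_bound => //; split; rewrite // in_unitE.
suff tsy : (t s <= y)%E by apply: le_trans tsy; exact: generator_le.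
move: s0; rewrite le_eqVlt => /predU1P[<-//|s0].
apply: (cvge_to_le (@t_lcont s _)); first by rewrite in_itv/= s0.
near=> x; have xs : x < s by near: x; exact: nbhs_left_lt.
have x0 : 0 <= x by near: x; exact: nbhs_left_ge.
have [w [w01 twy] xw] := sup_gt supS.1 xs.
move: w01; rewrite in_unitE => /andP[w0 w1].
by apply: le_trans twy; apply: generator_le => //; exact: ltW.
Unshelve. all: by end_near. Qed.

End Rlim0.

Lemma unit_le_ext {R : realType} (p q : R) : 0 <= p <= 1 -> 0 <= q <= 1 ->
  (forall z, 0 <= z <= 1 -> (z <= p) = (z <= q)) -> p = q.
Proof.
move=> p01 q01 pq; apply/eqP.
by rewrite eq_le -pq// lexx/= pq// lexx.
Qed.

(** * The generated operation *)

Section GeneratedOp.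
Context {R : realType} {F : \bar R -> \bar R -> \bar R} {t : R -> \bar R}.
Hypotheses (F_Gamma : Gamma F) (F_cont : Gamma_continuous F).
Hypothesis t_range : {in unit_itv R, forall x, t x \in nnereal R}.
Hypothesis t_nondecr : nondecreasing_unit t.
Hypothesis t_lcont : left_continuous_unit t.
Hypothesis t_nconst : ~ constant_unit t.
Local Notation T := (generated_op F t).
Local Notation a := (rlim0 t).
Implicit Types x y z w : R.

Lemma generator_ge0 x : 0 <= x <= 1 -> (0 <= t x)%E.
Proof. by move=> x01; rewrite -in_nnerealE t_range// in_unitE. Qed.

Lemma rlim0_ge0 : (0 <= a)%E.
Proof.
apply: le_trans (generator0_le_rlim0 t_nondecr).
by rewrite generator_ge0// lexx ler01.
Qed.

Lemma generated_op_unit x y : 0 <= T x y <= 1.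
Proof. exact: weak_pinv_unit. Qed.

(** The adjunction always applies, as F (t x) (t y) >= t x >= t 0. *)
Lemma le_generated_op x y z : 0 <= x <= 1 -> 0 <= y <= 1 -> 0 <= z <= 1 ->
  (z <= T x y) = (t z <= F (t x) (t y))%E.
Proof.
move=> x01 y01 z01; apply: le_weak_pinv => //.
apply: le_trans (Gamma_gel F_Gamma (generator_ge0 x01) (generator_ge0 y01)).
by have /andP[x0 x1] := x01; exact: generator_le.
Qed.

Lemma generated_op_gel x y : 0 <= x <= 1 -> 0 <= y <= 1 -> x <= T x y.
Proof.
by move=> x01 y01; rewrite le_generated_op// Gamma_gel// generator_ge0.
Qed.

Lemma generated_opC x y : 0 <= x <= 1 -> 0 <= y <= 1 -> T x y = T y x.
Proof. by move=> x01 y01; rewrite /generated_op Gamma_C// generator_ge0. Qed.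

Lemma generated_op_le x x' y y' : 0 <= x -> 0 <= y ->
  x <= x' -> y <= y' -> x' <= 1 -> y' <= 1 -> T x y <= T x' y'.
Proof.
move=> x0 y0 xx' yy' x'1 y'1.
have x01 : 0 <= x <= 1 by rewrite x0 (le_trans xx').
have y01 : 0 <= y <= 1 by rewrite y0 (le_trans yy').
have x'01 : 0 <= x' <= 1 by rewrite x'1 (le_trans x0).
have y'01 : 0 <= y' <= 1 by rewrite y'1 (le_trans y0).
have Txy := generated_op_unit x y.
rewrite le_generated_op//; apply: (@le_trans _ _ (F (t x) (t y))).
  by rewrite -le_generated_op.
by apply: Gamma_le2; rewrite ?generator_ge0// generator_le.
Qed.

(** * From continuous t-conorms to continuous increasing generators *)

Section Necessity.
Hypothesis Ft_lt : {in `]0, 1[ &, forall x y : R,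
  (F (t x) a < F (t x) (t y))%E}.
Hypothesis T_cont : continuous_unit2 T.
Hypothesis T_conorm : tconorm T.

Let T0 x : 0 <= x <= 1 -> T x 0 = x.
Proof. by move=> x01; rewrite (tconorm_neutral T_conorm)// in_unitE. Qed.

Let zero_unit : (0 : R) <= 0 <= (1 : R). Proof. by rewrite lexx ler01. Qed.
Let one_unit : (0 : R) <= 1 <= (1 : R). Proof. by rewrite lexx ler01. Qed.

(** By neutrality and adjunction, t y <= F (t x) (t 0) only when y <= x, while
    t x lies below F (t x) (t 0). *)
Lemma generator_increasing x y : 0 <= x -> x < y -> y <= 1 -> (t x < t y)%E.
Proof.
move=> x0 xy y1; have x01 : 0 <= x <= 1 by rewrite x0 (le_trans (ltW xy)).
have y01 : 0 <= y <= 1 by rewrite y1 (le_trans x0)// ltW.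
apply: (@le_lt_trans _ _ (F (t x) (t 0))).
  by rewrite Gamma_gel// generator_ge0.
by rewrite ltNge -le_generated_op// T0// -ltNge.
Qed.

Let T_cvg {X : Type} (G : set_system X) (FG : Filter G)
    (f g : X -> R) (u v : R) :
  0 <= u <= 1 -> 0 <= v <= 1 ->
  (\forall x \near G, 0 <= f x <= 1) -> (\forall x \near G, 0 <= g x <= 1) ->
  f @ G --> u -> g @ G --> v -> T (f x) (g x) @[x --> G] --> T u v.
Proof.
move=> u01 v01 f01 g01 fu gv.
apply: (within_square_cvg (A := [set` unit_itv R]) T_cont) fu gv;
  by rewrite /= ?in_unitE.
Qed.

Let near0_le : \forall s \near (0 : R)^'+, 0 <= s <= 1.
Proof.
by apply: filterS near0_unit => s; rewrite in_itv/= => /andP[/ltW-> /ltW->].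
Qed.

Let cvg0 : s @[s --> (0 : R)^'+] --> (0 : R).
Proof. by apply: cvg_within_filter; exact: cvg_id. Qed.

(** Near (0, 0) the values of T are below any given z > 0, so that
    F a a <= F (t s) (t s) < t z for s small enough. *)
Lemma rlim0_idempotent : F a a = a.
Proof.
apply/eqP; rewrite eq_le Gamma_gel ?rlim0_ge0// andbT.
apply: le_rlim0 => // z /andP[z0 z1].
have Tss_lt : \forall s \near (0 : R)^'+, T s s < z.
  by apply: (@cvg_near_lt _ _ _ _ _ _ (T 0 0));
    [exact: T_cvg cvg0 cvg0 | rewrite T0].
have [s [/= s01 Tsz]] := filter_ex (filterI near0_unit Tss_lt).
move: s01; rewrite in_itv/= => /andP[s0 s1].
have sle : 0 <= s <= 1 by rewrite !ltW.
apply: (@le_trans _ _ (F (t s) (t s))).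
  by apply: Gamma_le2; rewrite ?rlim0_ge0 ?rlim0_le// ltW.
by apply: ltW; rewrite ltNge -le_generated_op ?(ltW z0) ?(ltW z1)// -ltNge.
Qed.

Let cvg_sec {X : Type} (G : set_system X) (FG : Filter G) (f : X -> \bar R)
  (u v : \bar R) : (0 <= u)%E -> (0 <= v)%E ->
  (\forall x \near G, 0 <= f x)%E ->
  f @ G --> u -> F (f x) v @[x --> G] --> F u v.
Proof.
by move=> *; apply: Gamma_cvg => //; [exact: nearW | exact: cvg_cst].
Qed.

(** The set of fixed points of T (-) y is stable under the operation of T with
    any w; if x were fixed, it would thus contain the whole interval [x, 1],
    which is the range of T x.  Left continuity of t rules this out. *)
Lemma generated_op_gt x y : 0 < x < 1 -> 0 < y < 1 -> x < T x y.
Proof.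
move=> /andP[x0 x1] /andP[y0 y1].
have x01 : 0 <= x <= 1 by rewrite !ltW.
have y01 : 0 <= y <= 1 by rewrite !ltW.
rewrite lt_neqAle generated_op_gel// andbT; apply/eqP => /esym Txy.
have T1 : T x 1 = 1.
  apply/eqP; rewrite eq_le; have /andP[_ ->] := generated_op_unit x 1.
  by rewrite generated_opC//= generated_op_gel.
have Tzy z : x <= z <= 1 -> T z y = z.
  move=> /andP[xz z1].
  have [w] : exists2 w, w \in `[0, 1] & T x w = z.
    apply: IVT => //; last by rewrite T0// T1 min_l ?max_r ?xz ?z1// ltW.
    apply/subspace_continuousP => w /= w01.
    rewrite in_itv/= in w01.
    apply: T_cvg => //.
    - exact: nearW.
    - rewrite near_withinE; apply: nearW => v; by rewrite /= in_itv.
    - exact: cvg_cst.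
    - exact: cvg_within.
  rewrite in_itv/= => w01 <-.
  rewrite (generated_opC x01 w01) -(tconorm_assoc T_conorm) ?in_unitE//.
  by rewrite Txy.
(* Any point m of (x, 1) serves: it must have fixed points accumulating at its
   left, and be below 1 for the strict inequality on F to apply. *)
pose m := (x + 1) / 2.
have [xm m1] : x < m /\ m < 1 by rewrite !midf_lt.
have m0 : 0 < m by exact: lt_trans xm.
have m01 : 0 <= m <= 1 by rewrite !ltW.
have /negP[] : ~~ (F (t m) (t y) <= t m)%E.
  rewrite -ltNge; apply: (@le_lt_trans _ _ (F (t m) a)).
    by rewrite Gamma_gel// ?generator_ge0 ?rlim0_ge0.
  by apply: Ft_lt; rewrite in_itv/= ?m0 ?y0.
apply: (@cvge_to_le _ m^'- _ _ (fun z => F (t z) (t y))).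
  apply: cvg_sec; rewrite ?generator_ge0//; last first.
    by apply: t_lcont; rewrite in_itv/= m0 ltW.
  near=> z; apply: generator_ge0; apply/andP; split.
    by near: z; exact: nbhs_left_ge.
  by apply: (@le_trans _ _ m); [near: z; exact: nbhs_left_le | exact: ltW].
near=> z.
have xz : x < z by near: z; exact: nbhs_left_gt.
have zm : z < m by near: z; exact: nbhs_left_lt.
have z1 : z <= 1 by rewrite ltW// (lt_trans zm).
have z01 : 0 <= z <= 1 by rewrite z1 (le_trans (ltW x0))// ltW.
apply: ltW; rewrite ltNge -le_generated_op// -ltNge Tzy//.
by rewrite z1 ltW.
Unshelve. all: by end_near. Qed.

(** The witness is T x s for small s: it exceeds x, and its image under t is at
    most F (t x) (t s), which tends to F (t x) a = t x. *)
Lemma generator_right_continuous x e : 0 < x < 1 -> (t x < e)%E ->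
  exists2 z, x < z <= 1 & (t z < e)%E.
Proof.
move=> /andP[x0 x1] txe; have x01 : 0 <= x <= 1 by rewrite !ltW.
have Fs_lt : \forall s \near (0 : R)^'+, (F (t s) (t x) < e)%E.
  apply: (@cvg_near_lt _ _ _ _ _ _ (F a (t x))); last first.
    rewrite Gamma_C ?generator_ge0 ?rlim0_ge0//.
    rewrite Gamma_idempotent_neutral ?rlim0_ge0 ?rlim0_idempotent//.
    by rewrite rlim0_le// ltW.
  apply: cvg_sec; rewrite ?generator_ge0 ?rlim0_ge0//; last exact: rlim0_cvg.
  by apply: filterS near0_le => s; exact: generator_ge0.
have [s [/= s01 Fse]] := filter_ex (filterI near0_unit Fs_lt).
move: s01; rewrite in_itv/= => s01; have /andP[s0 s1] := s01.
have sle : 0 <= s <= 1 by rewrite !ltW.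
have := generated_op_unit x s => /andP[T0s T1s].
exists (T x s); first by rewrite T1s andbT generated_op_gt// x0.
apply: le_lt_trans Fse; rewrite Gamma_C ?generator_ge0//.
by rewrite -le_generated_op// T0s.
Qed.

Lemma generator_left_continuous x e : 0 < x <= 1 -> (e < t x)%E ->
  exists2 z, 0 < z < x & (e < t z)%E.
Proof.
move=> x01 etx; have /andP[x0 _] := x01.
have near_e : \forall z \near x^'-, (e < t z)%E.
  by apply: cvg_near_gt etx; apply: t_lcont; rewrite in_itv.
have near_x : \forall z \near x^'-, 0 < z < x.
  near=> z; apply/andP; split; near: z; first exact: nbhs_left_gt.
  exact: nbhs_left_lt.
have [z [etz z0x]] : exists z, (e < t z)%E /\ 0 < z < x.
  by apply: (@filter_ex _ x^'-); exact: filterI near_e near_x.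
by exists z.
Unshelve. all: by end_near. Qed.

Lemma generator_continuous : {within `]0, 1], continuous t}.
Proof.
apply/subspace_continuousP => x /=; rewrite in_itv/= => /andP[x0 x1].
apply: cvg_order => e.
  move=> etx.
  have x01 : 0 < x <= 1 by rewrite x0.
  have [z /andP[z0 zx] etz] := generator_left_continuous x01 etx.
  rewrite near_withinE; near=> y => /=; rewrite in_itv/= => /andP[y0 y1].
  apply: (lt_le_trans etz); apply: generator_le => //; first exact: ltW.
  by apply: ltW; near: y; exact: lt_nbhsr.
move=> txe; rewrite near_withinE.
move: x1; rewrite le_eqVlt => /predU1P[xe|x1].
  apply: nearW => y /=; rewrite in_itv/= => /andP[y0 y1].
  by apply: le_lt_trans txe; apply: generator_le; rewrite ?xe // ltW.
have x01 : 0 < x < 1 by rewrite x0.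
have [z /andP[xz z1] tze] := generator_right_continuous x01 txe.
near=> y => /=; rewrite in_itv/= => /andP[y0 y1].
apply: le_lt_trans tze; apply: generator_le => //; first exact: ltW.
by apply: ltW; near: y; exact: lt_nbhsl.
Unshelve. all: by end_near. Qed.

End Necessity.

(** * From continuous increasing generators to continuous t-conorms *)

Section Sufficiency.
Hypothesis t_cont : {within `]0, 1], continuous t}.
Hypothesis t_incr : {in `]0, 1] &, forall x y : R, x < y -> (t x < t y)%E}.
Hypothesis Faa : F a a = a.

Let zero_unit : (0 : R) <= 0 <= (1 : R). Proof. by rewrite lexx ler01. Qed.
Let one_unit : (0 : R) <= 1 <= (1 : R). Proof. by rewrite lexx ler01. Qed.
Let pos_unit x : 0 < x <= 1 -> 0 <= x <= 1.
Proof. by move=> /andP[/ltW-> ->]. Qed.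

Let t_lt x y : 0 < x -> x < y -> y <= 1 -> (t x < t y)%E.
Proof.
move=> x0 xy y1; apply: t_incr; rewrite // in_itv/= ?x0 ?y1 ?andbT/=.
  exact: le_trans (ltW xy) y1.
exact: lt_trans xy.
Qed.

Let rlim0_lt x : 0 < x <= 1 -> (a < t x)%E.
Proof.
move=> /andP[x0 x1]; have x20 : 0 < x / 2 by rewrite divr_gt0.
have x2x : x / 2 < x by rewrite gtr_pMr// invf_lt1// ltr1n.
apply: (@le_lt_trans _ _ (t (x / 2))); last exact: t_lt.
by apply: rlim0_le => //; rewrite (le_trans (ltW x2x)).
Qed.

Let t_leE x z : 0 < x <= 1 -> 0 <= z <= 1 -> (t z <= t x)%E = (z <= x).
Proof.
move=> /andP[x0 x1] /andP[z0 z1]; apply/idP/idP => [|zx]; last first.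
  exact: generator_le.
by apply: contraTT; rewrite -!ltNge => xz; exact: t_lt.
Qed.

Let rlim0_le_t0 z : 0 <= z <= 1 -> (t z <= a)%E = (z <= 0).
Proof.
move=> /andP[z0 z1]; apply/idP/idP => [|zle].
  by apply: contraTT; rewrite -!ltNge => zgt; apply: rlim0_lt; rewrite zgt.
by rewrite (_ : z = 0) ?generator0_le_rlim0//; apply: le_anti; rewrite zle.
Qed.

(** The continuous extension to [0, 1] of the restriction of t to (0, 1]. *)
Definition rlim0_extension x : \bar R := if x <= 0 then a else t x.
Local Notation t' := rlim0_extension.

Let t'_ge x : 0 <= x <= 1 -> (a <= t' x)%E.
Proof.
by move=> /andP[x0 x1]; rewrite /t'; case: (leP x 0) => // xgt; exact: rlim0_le.
Qed.

Let t'_leE x z : 0 <= x <= 1 -> 0 <= z <= 1 -> (t z <= t' x)%E = (z <= x).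
Proof.
move=> /andP[x0 x1] z01; rewrite /t'; case: (leP x 0) => [xle|xgt].
  have -> : x = 0 by apply: le_anti; rewrite x0 xle.
  exact: rlim0_le_t0.
by rewrite t_leE// xgt.
Qed.

(** Both t 0 and a are neutral for the values of t at positive arguments; at
    x = 0 the value F (t 0) (t 0) lies in [t 0, a], where t takes no value of a
    positive argument. *)
Lemma generated_op0 x : 0 <= x <= 1 -> T x 0 = x.
Proof.
move=> x01; apply: unit_le_ext => //; first exact: generated_op_unit.
move=> z z01; rewrite le_generated_op//.
have t00 := generator_ge0 zero_unit; have t0a := generator0_le_rlim0 t_nondecr.
have /andP[] := x01; rewrite le_eqVlt => /predU1P[<- _|x0 x1].
  apply/idP/idP => [tz|z0]; last first.
    have -> : z = 0 by apply: le_anti; rewrite z0; have /andP[-> _] := z01.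
    exact: Gamma_gel.
  rewrite -rlim0_le_t0//; apply: (le_trans tz); rewrite -[leRHS]Faa.
  exact: Gamma_le2.
rewrite (Gamma_idempotent_neutral_le F_Gamma F_cont rlim0_ge0 Faa)//.
  by rewrite t_leE// x0.
exact: rlim0_le.
Qed.

(** In the right-hand side the generator may be traded for its continuous
    extension: if x = 0, both F a (t' y) and T 0 y reduce to their second
    argument by neutrality, and likewise if y = 0. *)
Lemma le_generated_op_ext x y z : 0 <= x <= 1 -> 0 <= y <= 1 -> 0 <= z <= 1 ->
  (z <= T x y) = (t z <= F (t' x) (t' y))%E.
Proof.
move=> x01 y01 z01.
have [x0 x1] := andP x01; have [y0 y1] := andP y01.
move: y0; rewrite le_eqVlt => /predU1P[<-|y0].
  rewrite generated_op0// {2}/t' lexx.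
  rewrite (Gamma_idempotent_neutral F_Gamma F_cont rlim0_ge0 Faa) ?t'_ge//.
  by rewrite t'_leE.
move: x0; rewrite le_eqVlt => /predU1P[<-|x0].
  rewrite generated_opC// generated_op0// {1}/t' lexx.
  rewrite Gamma_C ?rlim0_ge0//; last exact: le_trans rlim0_ge0 (t'_ge _).
  rewrite (Gamma_idempotent_neutral F_Gamma F_cont rlim0_ge0 Faa) ?t'_ge//.
  by rewrite t'_leE.
by rewrite /t' !leNgt x0 y0/= -!leNgt le_generated_op.
Qed.

Lemma rlim0_extension_cvg x : 0 <= x <= 1 ->
  t' z @[z --> within `[0, 1] (nbhs x)] --> t' x.
Proof.
move=> /andP[]; rewrite le_eqVlt => /predU1P[<- _|x0 x1].
  apply: cvg_order => e; rewrite {1}/t' lexx => ae; rewrite near_withinE.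
    apply: nearW => z /=; rewrite in_itv/= => z01.
    exact: lt_le_trans (t'_ge z01).
  have [s s01 tse] : exists2 s, 0 < s < 1 & (t s < e)%E.
    apply: contrapT => nos; move: ae; apply/negP; rewrite -leNgt.
    apply: le_rlim0 => // s s01; rewrite leNgt; apply/negP => tse.
    by apply: nos; exists s.
  have /andP[s0 s1] := s01.
  near=> z => /=; rewrite in_itv/= => /andP[z0 z1].
  rewrite /t'; case: ifP => // _; apply: le_lt_trans tse.
  apply: generator_le => //; last exact: ltW.
  by apply: ltW; near: z; exact: lt_nbhsl.
have t'x : t' x = t x by rewrite /t' leNgt x0.
have tx : t z @[z --> within `]0, 1] (nbhs x)] --> t x.
  by move/subspace_continuousP: t_cont; apply; rewrite /= in_itv/= x0.
apply: cvg_order => e; rewrite t'x => etx; rewrite near_withinE.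
  have near_e : \forall z \near x, z \in `]0, 1] -> (e < t z)%E.
    exact: cvg_near_gt tx etx.
  near=> z => /=; rewrite in_itv/= => /andP[_ z1].
  have z0 : 0 < z by near: z; exact: lt_nbhsr.
  rewrite /t' leNgt z0/=.
  have : z \in `]0, 1] -> (e < t z)%E by near: z; exact: near_e.
  by apply; rewrite in_itv/= z0.
have near_e : \forall z \near x, z \in `]0, 1] -> (t z < e)%E.
  exact: cvg_near_lt tx etx.
near=> z => /=; rewrite in_itv/= => /andP[_ z1].
have z0 : 0 < z by near: z; exact: lt_nbhsr.
rewrite /t' leNgt z0/=.
have : z \in `]0, 1] -> (t z < e)%E by near: z; exact: near_e.
by apply; rewrite in_itv/= z0.
Unshelve. all: by end_near. Qed.

(** T x y < e and T x y > e amount to strict inequalities between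
    F (t' x) (t' y) and a fixed value of t, which are open conditions. *)
Lemma generated_op_continuous : continuous_unit2 T.
Proof.
apply/subspace_continuousP => -[x y] /= [].
rewrite !in_unitE => x01 y01.
set sq := [set` unit_itv R] `*` [set` unit_itv R].
have Gc : F (t' p.1) (t' p.2) @[p --> within sq (nbhs (x, y))] -->
    F (t' x) (t' y).
  have t'0 z : 0 <= z <= 1 -> (0 <= t' z)%E.
    by move=> /t'_ge; apply: le_trans rlim0_ge0.
  apply: Gamma_cvg => //; try exact: t'0.
  - rewrite near_withinE; apply: nearW => -[u v] /= [/=].
    by rewrite !in_unitE => /t'0.
  - rewrite near_withinE; apply: nearW => -[u v] /= [/=].
    by rewrite !in_unitE => _ /t'0.
  - apply: cvg_comp (rlim0_extension_cvg x01) => W /= Wx.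
    have : nbhs (x, y) (fst @^-1` (fun z => z \in `[0, 1] -> W z)).
      exact: cvg_fst.
    by apply: filterS => -[u v] /= H [u01 _]; exact: H.
  - apply: cvg_comp (rlim0_extension_cvg y01) => W /= Wx.
    have : nbhs (x, y) (snd @^-1` (fun z => z \in `[0, 1] -> W z)).
      exact: cvg_snd.
    by apply: filterS => -[u v] /= H [_ v01]; exact: H.
have /andP[T0 T1] := generated_op_unit x y.
apply: cvg_order => e /= eT.
  have [e0|e0] := ltP e 0.
    apply: nearW => -[u v] /=; apply: (lt_le_trans e0).
    by have /andP[] := generated_op_unit u v.
  (* At z = T x y the adjunction only gives a weak inequality; passing to a
     point strictly below makes it strict. *)
  pose m := (e + T x y) / 2.
  have [em mT] : e < m /\ m < T x y by rewrite !midf_lt.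
  have m0 : 0 < m by exact: le_lt_trans em.
  have m1 : m < 1 by exact: lt_le_trans T1.
  have tm : (t m < F (t' x) (t' y))%E.
    apply: (@lt_le_trans _ _ (t (T x y))); first exact: t_lt.
    by rewrite -le_generated_op_ext// T0 T1.
  have near_m : \forall p \near (x, y), sq p -> (t m < F (t' p.1) (t' p.2))%E.
    exact: cvg_near_gt Gc tm.
  rewrite near_withinE; apply: filterS near_m => -[u v] /= H uv.
  have := H uv; have [/=] := uv; rewrite !in_unitE => u01 v01 /ltW.
  have m01 : 0 <= m <= 1 by rewrite !ltW.
  by rewrite -le_generated_op_ext//; exact: lt_le_trans em.
have e0 : 0 <= e by exact: le_trans T0 (ltW eT).
have [e1|e1] := ltP 1 e.
  apply: nearW => -[u v] /=; apply: le_lt_trans e1.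
  by have /andP[] := generated_op_unit u v.
have e01 : 0 <= e <= 1 by rewrite e0 e1.
have te : (F (t' x) (t' y) < t e)%E.
  by rewrite ltNge -le_generated_op_ext// -ltNge.
have near_e : \forall p \near (x, y), sq p -> (F (t' p.1) (t' p.2) < t e)%E.
  exact: cvg_near_lt Gc te.
rewrite near_withinE; apply: filterS near_e => -[u v] /= H uv.
have := H uv; have [/=] := uv; rewrite !in_unitE => u01 v01.
by rewrite !ltNge -le_generated_op_ext.
Qed.

(** Were t (T x y) < F (t x) (t y), right continuity would give z > T x y that
    still satisfies t z <= F (t x) (t y). *)
Lemma generator_generated_op x y : 0 < x <= 1 -> 0 <= y <= 1 -> T x y < 1 ->
  t (T x y) = F (t x) (t y).
Proof.
move=> x01 y01; have x01' := pos_unit x01.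
set p := T x y => p1; have p01 : 0 <= p <= 1 := generated_op_unit x y.
have /andP[x0 x1] := x01.
have p0 : 0 < p by apply: lt_le_trans x0 _; exact: generated_op_gel.
apply/eqP; rewrite eq_le -le_generated_op// lexx/= leNgt; apply/negP => tpF.
have tp : t z @[z --> within `]0, 1] (nbhs p)] --> t p.
  by move/subspace_continuousP: t_cont; apply; rewrite /= in_itv/= p0 ltW.
have near_p : \forall z \near p, z \in `]0, 1] -> (t z < F (t x) (t y))%E.
  exact: cvg_near_lt tp tpF.
have near_lt : \forall z \near p^'+, z \in `]0, 1] -> (t z < F (t x) (t y))%E.
  exact: cvg_within near_p.
have [z [tzF pz z1]] : exists z, [/\ (t z < F (t x) (t y))%E, p < z & z <= 1].
  apply: (@filter_ex _ p^'+); near=> z.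
  have pz : p < z by near: z; exact: nbhs_right_gt.
  have z1 : z <= 1 by near: z; exact: nbhs_right_le.
  split => //; have : z \in `]0, 1] -> (t z < F (t x) (t y))%E.
    by near: z; exact: near_lt.
  by apply; rewrite in_itv/= z1 (lt_trans p0).
have z01 : 0 <= z <= 1 by rewrite z1 ltW// (lt_trans p0).
by move: pz; rewrite ltNge le_generated_op// ltW.
Unshelve. all: by end_near. Qed.

(** If T y w < 1 then t (T y w) is exactly F (t y) (t w). Otherwise truncation
    has occurred, but then F (t y) (t w) >= t 1 and both sides are true. *)
Lemma le_generated_op2 x y w z : 0 < x <= 1 -> 0 < y <= 1 -> 0 < w <= 1 ->
  0 <= z <= 1 ->
  (z <= T x (T y w)) = (t z <= F (t x) (F (t y) (t w)))%E.
Proof.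
move=> x01 y01 w01 z01; have x01' := pos_unit x01.
have y01' := pos_unit y01; have w01' := pos_unit w01.
have T01 := generated_op_unit y w; rewrite le_generated_op//.
have [Tlt|] := ltP (T y w) 1; first by rewrite generator_generated_op.
move=> Tge; have Tyw : T y w = 1.
  by apply: le_anti; rewrite Tge; have /andP[_ ->] := T01.
have tz1 : (t z <= t 1)%E by have /andP[z0 z1] := z01; exact: generator_le.
have F0 : (0 <= F (t y) (t w))%E by rewrite Gamma_ge0// generator_ge0.
have t1F : (t 1 <= F (t y) (t w))%E by rewrite -le_generated_op// Tyw.
rewrite Tyw (le_trans tz1) ?Gamma_ger ?generator_ge0//; apply/esym.
by rewrite (le_trans tz1)// (le_trans t1F)// Gamma_ger// generator_ge0.
Qed.

Lemma generated_opA x y w : 0 <= x <= 1 -> 0 <= y <= 1 -> 0 <= w <= 1 ->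
  T x (T y w) = T (T x y) w.
Proof.
move=> x01 y01 w01.
have T01 u v : 0 <= T u v <= 1 := generated_op_unit u v.
have T0l u : 0 <= u <= 1 -> T 0 u = u.
  by move=> u01; rewrite generated_opC// generated_op0.
have [x0 x1] := andP x01; have [y0 y1] := andP y01; have [w0 w1] := andP w01.
move: x0; rewrite le_eqVlt => /predU1P[<-|x0]; first by rewrite !T0l.
move: y0; rewrite le_eqVlt => /predU1P[<-|y0].
  by rewrite T0l// generated_op0.
move: w0; rewrite le_eqVlt => /predU1P[<-|w0]; first by rewrite !generated_op0.
apply: unit_le_ext => // z z01.
rewrite [T (T x y) w]generated_opC// !le_generated_op2 ?x0 ?y0 ?w0//.
rewrite Gamma_A ?generator_ge0// (Gamma_C F_Gamma (generator_ge0 w01))//.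
by rewrite Gamma_ge0 ?generator_ge0.
Qed.

Lemma generated_op_tconorm : tconorm T.
Proof.
split.
- by move=> x y _ _; rewrite in_unitE generated_op_unit.
- by move=> x y; rewrite !in_unitE; exact: generated_opC.
- by move=> x y z; rewrite !in_unitE; exact: generated_opA.
- move=> x y z; rewrite !in_unitE => /andP[x0 _] /andP[_ y1] /andP[z0 z1] xy.
  exact: generated_op_le.
- move=> x y z; rewrite !in_unitE => /andP[x0 _] /andP[_ y1] /andP[z0 z1] xy.
  exact: generated_op_le.
- by move=> x; rewrite in_unitE; exact: generated_op0.
Qed.

End Sufficiency.

End GeneratedOp.

Theorem theorem6p5 (R : realType) (F : \bar R -> \bar R -> \bar R)
    (t : R -> \bar R)
    (F_Gamma : Gamma F)
    (F_cont : Gamma_continuous F)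
    (t_range : {in unit_itv R, forall x, t x \in nnereal R})
    (t_nondecr : nondecreasing_unit t)
    (t_lcont : left_continuous_unit t)
    (Ft_lt : {in `]0, 1[ &, forall x y : R,
      (F (t x) (rlim0 t) < F (t x) (t y))%E}) :
  let T := generated_op F t in
  (continuous_unit2 T /\ tconorm T) <->
  ({within `]0, 1], continuous t} /\
   {in `]0, 1] &, forall x y : R, x < y -> (t x < t y)%E} /\
   F (rlim0 t) (rlim0 t) = rlim0 t).
Proof.
move=> T.
have t_nconst : ~ constant_unit t.
  move=> tc; pose h : R := 1 / 2.
  have h0 : 0 < h by rewrite divr_gt0.
  have h1 : h < 1 by rewrite ltr_pdivrMr// mul1r ltr1n.
  have h01 : h \in `]0, 1[ by rewrite in_itv/= h0.
  have h_unit : h \in unit_itv R by rewrite in_unitE !ltW.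
  have := Ft_lt _ _ h01 h01; apply/negP; rewrite -leNgt.
  have th : t h = t 0 by apply: tc; rewrite // in_unitE lexx ler01.
  have th0 : (0 <= t h)%E by rewrite -in_nnerealE t_range.
  by apply: Gamma_le2 => //; rewrite th; exact: generator0_le_rlim0.
split=> [[T_cont T_conorm]|[t_cont [t_incr Faa]]].
  split; first exact: (generator_continuous F_Gamma F_cont).
  split; last exact: (rlim0_idempotent F_Gamma).
  move=> x y; rewrite !in_itv/= => /andP[x0 _] /andP[_ y1] xy.
  by apply: (generator_increasing F_Gamma) => //; exact: ltW.
split; first exact: generated_op_continuous.
exact: generated_op_tconorm.
Qed.
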